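(* For any graph $G$ of order $n$ and any nonempty graph $H$, $$\gamma_{\rm sp}(G\odot H)=n(\gamma_{\rm sp}(H)+1).$$ Furthermore, for any integer $r\ge 1$, $$\gamma_{\rm sp}(G\odot N_r)=nr.$$
   Context: All graphs are finite, simple and undirected. A graph is nonempty if it has at least one edge; $N_r$ denotes the graph with $r$ vertices and no edges. For a vertex $v$, $N(v)$ is its set of neighbours; for $D\subseteq V(G)$, $\overline{D}=V(G)\setminus D$. A set $D\subseteq V(G)$ is a super dominating set of $G$ if for every $u\in\overline{D}$ there exists $v\in D$ such that $N(v)\cap\overline{D}=\{u\}$; the super domination number $\gamma_{\rm sp}(G)$ is the minimum cardinality of a super dominating set of $G$. The corona product $G\odot H$ is obtained by taking one copy of $G$ and $|V(G)|$ copies of $H$, and joining by an edge each vertex of the $i$-th copy of $H$ to the $i$-th vertex of $G$. *)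

(* Defs.v *)
From mathcomp Require Import all_boot.

Set Implicit Arguments.
Unset Strict Implicit.
Unset Printing Implicit Defensive.

Record sgraph := SGraph {
  vertex :> finType;
  adj : rel vertex;
  adj_sym : symmetric adj;
  adj_irrefl : irreflexive adj }.

Definition neigh (G : sgraph) (v : G) : {set G} := [set w | adj v w].

Definition nonempty_graph (G : sgraph) : Prop := exists x y : G, adj x y.

Definition super_dominating (G : sgraph) (D : {set G}) : bool :=
  [forall u in ~: D, exists v in D, neigh v :&: ~: D == [set u]].

Lemma super_dominating_setT (G : sgraph) : super_dominating [set: G].
Proof. by apply/forall_inP => u; rewrite setCT inE. Qed.

(* [set: G] only serves as the default of arg min; it is admissible by
   super_dominating_setT, so the minimum below is the genuine one. *)
Definition gamma_sp (G : sgraph) : nat :=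
  #|[arg min_(D < [set: G] | super_dominating D) #|D|]|.

Lemma gamma_spP (G : sgraph) :
  (exists2 D : {set G}, super_dominating D & #|D| = gamma_sp G) /\
  (forall D : {set G}, super_dominating D -> gamma_sp G <= #|D|).
Proof.
rewrite /gamma_sp; case: arg_minnP => [|D sD minD].
  exact: super_dominating_setT.
by split; [exists D | exact: minD].
Qed.

Section Null.
Variable r : nat.

Definition null_adj : rel 'I_r := fun _ _ => false.

Fact null_adj_sym : symmetric null_adj. Proof. by []. Qed.

Fact null_adj_irrefl : irreflexive null_adj. Proof. by []. Qed.

Definition null_graph : sgraph := SGraph null_adj_sym null_adj_irrefl.

End Null.

Section Corona.
Variables G H : sgraph.

(* inl g is the vertex g of G; inr (g, h) is the vertex h in the copy of H
   attached to g. *)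
Definition corona_adj : rel (G + G * H)%type := fun x y =>
  match x, y with
  | inl g, inl g' => adj g g'
  | inl g, inr (g', _) => g == g'
  | inr (g, _), inl g' => g == g'
  | inr (g, h), inr (g', h') => (g == g') && adj h h'
  end.

Fact corona_adj_sym : symmetric corona_adj.
Proof.
by move=> [g|[g h]] [g'|[g' h']] /=; rewrite ?(eq_sym g) // adj_sym.
Qed.

Fact corona_adj_irrefl : irreflexive corona_adj.
Proof. by move=> [g|[g h]] /=; rewrite adj_irrefl ?andbF. Qed.

Definition corona : sgraph := SGraph corona_adj_sym corona_adj_irrefl.

End Corona.

(* Main.v *)
Require Import Defs.
From mathcomp Require Import all_boot.

Set Implicit Arguments.
Unset Strict Implicit.

(** For D super dominating in the corona, let D_g be the trace of D on the copy
    of H at g.  A vertex of that copy outside D is dominated either from within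
    the copy, which requires g to be in D, or by g itself, which requires g to be
    in D and the vertex to be the only one of the copy missing from D.  Hence
    either g is outside D and D_g is the whole copy, or g is in D and D_g is
    super dominating in H or misses exactly one vertex.  Both lower bounds
    follow by summing over g. *)

Lemma super_dominatingP (G : sgraph) (D : {set G}) :
  reflect (forall u, u \notin D -> exists2 v, v \in D &
             forall w, (adj v w && (w \notin D)) = (w == u))
          (super_dominating D).
Proof.
apply: (iffP forall_inP) => sD u.
  move=> uD; have /sD/exists_inP[v vD /eqP/setP eD] : u \in ~: D by rewrite inE.
  by exists v => // w; move: (eD w); rewrite !inE.
rewrite inE => /sD[v vD eD]; apply/exists_inP; exists v => //.
by apply/eqP/setP => w; rewrite !inE eD.
Qed.

Lemma gamma_sp_eq (G : sgraph) (k : nat) (D0 : {set G}) :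
  super_dominating D0 -> #|D0| = k ->
  (forall D : {set G}, super_dominating D -> k <= #|D|) -> gamma_sp G = k.
Proof.
move=> sD0 cD0 lbk; have [[D sD cD] minG] := gamma_spP G.
by apply/eqP; rewrite eqn_leq -{1}cD0 minG // -cD lbk.
Qed.

(** If [xy] is an edge, all vertices but [x] form a super dominating set, with [y] dominating [x].
    Strictness is what allows the bound [gamma_sp H + 1] in the corona to be at most [#|H|]. *)
Lemma gamma_sp_lt_order (G : sgraph) : nonempty_graph G -> gamma_sp G < #|G|.
Proof.
move=> [x [y xy]]; rewrite [#|G|](cardD1 x) inE add1n ltnS -cardsE.
have neq_yx : y != x by apply: contraTneq xy => ->; rewrite adj_irrefl.
apply: (gamma_spP G).2; apply/super_dominatingP => u.
rewrite !inE !andbT negbK => /eqP->; exists y => [|w]; rewrite !inE ?andbT //.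
by rewrite negbK; case: eqP => [->|]; rewrite ?andbF // adj_sym xy.
Qed.

Lemma super_dominating_null_graph (r : nat) (D : {set null_graph r}) :
  super_dominating D -> D = [set: null_graph r].
Proof.
move=> /super_dominatingP sD; apply/setP => u; rewrite inE.
by apply: contraT => /sD[v _ /(_ u)]; rewrite eqxx.
Qed.

Section Corona.
Variables G H : sgraph.

Definition corona_fiber (D : {set corona G H}) (g : G) : {set H} :=
  [set h | (inr (g, h) : corona G H) \in D].

(** The extremal sets of both formulas have this uniform shape: [b] decides for all vertices of [G]
    at once, and every copy of [H] has the same trace. *)
Definition corona_set (b : bool) (S : {set H}) : {set corona G H} :=
  [set x : corona G H | match x with inl _ => b | inr (_, h) => h \in S end].

Lemma card_corona_set_sum (D : {set corona G H}) :
  #|D| = \sum_(g : G) (((inl g : corona G H) \in D) + #|corona_fiber D g|).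
Proof.
rewrite -sum1_card big_mkcond big_sumType big_split /=; congr (_ + _).
transitivity (\sum_(g : G) \sum_(h : H) ((inr (g, h) : corona G H) \in D : nat)).
  by rewrite pair_big; apply: eq_bigr => -[g h] _ /=; case: (_ \in D).
apply: eq_bigr => g _; rewrite -sum1_card [RHS]big_mkcond.
by apply: eq_bigr => h _; rewrite inE; case: (_ \in D).
Qed.

Lemma card_corona_set (b : bool) (S : {set H}) :
  #|corona_set b S| = #|G| * (b + #|S|).
Proof.
rewrite card_corona_set_sum -sum_nat_const; apply: eq_bigr => g _.
rewrite inE; suff -> : corona_fiber (corona_set b S) g = S by [].
by apply/setP => h; rewrite !inE.
Qed.

(** A dominator inside a copy gains only one new neighbour, the vertex of [G] it hangs from, and
    that one is in the set. *)
Lemma corona_setT_super_dominating (S : {set H}) :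
  super_dominating S -> super_dominating (corona_set true S).
Proof.
move=> /super_dominatingP sS; apply/super_dominatingP => -[g|[g u]]; rewrite inE //.
move=> /sS[v vS eS]; exists (inr (g, v)); first by rewrite inE.
move=> [g'|[g' w]]; rewrite inE /= ?andbF //.
by rewrite -andbA eS eq_sym.
Qed.

(** Each missing vertex [g] is dominated by [h0] in its own copy, whose other neighbours all lie in
    that copy. *)
Lemma corona_setF_super_dominating (h0 : H) :
  super_dominating (corona_set false [set: H]).
Proof.
apply/super_dominatingP => -[g|[g u]]; rewrite !inE // => _.
exists (inr (g, h0)); first by rewrite !inE.
by move=> [g'|[g' w]]; rewrite !inE /= ?andbF // andbT eq_sym.
Qed.

Lemma corona_fiberT (D : {set corona G H}) (g : G) :
  super_dominating D -> (inl g : corona G H) \notin D ->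
  corona_fiber D g = [set: H].
Proof.
move=> /super_dominatingP sD gD; apply/setP => u; rewrite !inE.
apply: contraT => /sD[[g1|[g1 v]] vD eD].
  move: (eD (inr (g, u))); rewrite eqxx => /andP[/= /eqP eg _].
  by rewrite eg (negPf gD) in vD.
move: (eD (inr (g, u))); rewrite eqxx => /andP[/= /andP[/eqP eg _] _].
(* A dominator [v] inside the copy would have [g] as a second missing neighbour. *)
by move: (eD (inl g)); rewrite /= eg eqxx gD.
Qed.

Lemma corona_fiber_super_dominating (D : {set corona G H}) (g : G) :
  super_dominating D -> (inl g : corona G H) \in D ->
  super_dominating (corona_fiber D g) \/ exists u, corona_fiber D g = ~: [set u].
Proof.
move=> /super_dominatingP sD gD.
case: (boolP (super_dominating _)) => [|nsD]; [by left | right].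
have [/existsP[u /eqP eu]|no1] := boolP [exists u, corona_fiber D g == ~: [set u]].
  by exists u.
case/super_dominatingP: nsD => u; rewrite inE => /sD[[g1|[g1 v]] vD eD].
  (* The dominator is [g] itself. It sees the whole copy, so [u] is the only vertex missing there,
     against [no1]. *)
  case/existsP: no1; exists u; apply/eqP/setP => w; rewrite !inE.
  move: (eD (inr (g, u))) (eD (inr (g, w))); rewrite eqxx => /andP[/= /eqP-> _].
  by rewrite eqxx /= => /(congr1 negb); rewrite negbK => ->; rewrite /eq_op /= /eq_op /= eqxx.
move: (eD (inr (g, u))); rewrite eqxx => /andP[/= /andP[/eqP eg _] _].
rewrite eg in vD eD; exists v; first by rewrite inE.
move=> w; move: (eD (inr (g, w))); rewrite inE /= eqxx /= => ->.
by rewrite /eq_op /= /eq_op /= eqxx.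
Qed.

(** Shared lower bound, used with [k = gamma_sp H + 1] and with [k = r]: each [g] together with its
    copy contributes at least [k] to [D]. *)
Lemma leq_card_corona (k : nat) (D : {set corona G H}) :
  k <= #|H| -> (forall S : {set H}, super_dominating S -> k <= #|S|.+1) ->
  super_dominating D -> #|G| * k <= #|D|.
Proof.
move=> kH kS sD; rewrite card_corona_set_sum -sum_nat_const.
apply: leq_sum => g _; case: (boolP (_ \in D)) => [gD | /(corona_fiberT sD) ->].
  have [/kS//|[u ->]] := corona_fiber_super_dominating sD gD.
  (* Here [g] makes up for the one missing vertex, so the contribution is exactly [#|H|]. *)
  by move: kH; rewrite -(cardsC [set u]) cards1.
by rewrite cardsT.
Qed.

End Corona.

Theorem theorem18 (n : nat) (G : sgraph) (order_G : #|G| = n) :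
  (forall H : sgraph, nonempty_graph H ->
     gamma_sp (corona G H) = n * (gamma_sp H + 1)) /\
  (forall r : nat, 1 <= r ->
     gamma_sp (corona G (null_graph r)) = n * r).
Proof.
rewrite -order_G; split=> [H neH | r r_gt0].
  have [[S sS cS] minH] := gamma_spP H.
  apply: (gamma_sp_eq (corona_setT_super_dominating G sS)).
    by rewrite card_corona_set cS addnC.
  move=> D; rewrite addn1; apply: leq_card_corona; first exact: gamma_sp_lt_order.
  by move=> T /minH.
(* The hypothesis [1 <= r] provides vertex 0 of [null_graph r] as the dominator in each copy. *)
apply: (gamma_sp_eq (corona_setF_super_dominating G (Ordinal r_gt0 : null_graph r))).
  by rewrite card_corona_set cardsT card_ord.
move=> D; apply: leq_card_corona => [|S /super_dominating_null_graph ->].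
  by rewrite card_ord.
by rewrite cardsT card_ord.
Qed.
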